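(* Let $g:\mathbb{N}\to\mathbb{C}$ be an arithmetic function, where $\mathbb{N}$ is the set of positive integers, and let $$F_g(x)=\exp\left(-\sum_{n\ge1}\frac{g(n)}{n}x^n\right)\in\mathbb{C}[[x]].$$ Then $F_g(x)$ admits the Euler-product expansion $$F_g(x)=\prod_{m\ge1}(1-x^m)^{\beta_g(m)},$$ where the exponents $\beta_g(m)$ are given, for every $m\ge 1$, by $$\beta_g(m)=\frac1m\sum_{d\mid m}\mu(d)\,g(m/d),$$ equivalently $m\,\beta_g(m)=(\mu*g)(m)$.
   Context: All identities are in the ring of formal power series $\mathbb{C}[[x]]$. For $\beta\in\mathbb{C}$ and $m\ge1$, $(1-x^m)^{\beta}$ denotes the formal power series $\exp(\beta\log(1-x^m))$ with $\log(1-x^m)=-\sum_{r\ge1}x^{mr}/r$; infinite products are taken in the usual ($x$-adic) sense. $\mu$ is the Möbius function, and $(f*h)(n)=\sum_{d\mid n}f(d)h(n/d)$ is Dirichlet convolution. $F_g$ is called the formal Bell transform of $g$ and the numbers $\beta_g(m)$ its Bell exponents. *)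

(* Defs.v *)
From HB Require Import structures.
From mathcomp Require Import all_boot all_order all_algebra.
From mathcomp Require Import boolp reals complex.

Set Implicit Arguments.
Unset Strict Implicit.
Unset Printing Implicit Defensive.

Import GRing.Theory.
Local Open Scope ring_scope.

(* A record rather than an alias of [nat -> K], so that the Cauchy product does
   not compete with the pointwise ring structure on functions. *)
Record fps (K : Type) := Fps { fcoef : nat -> K }.

Lemma fpsP (K : Type) (f h : fps K) :
  (forall n, fcoef f n = fcoef h n) -> f = h.
Proof. by case: f => f; case: h => h /= /funext ->. Qed.

HB.instance Definition _ (K : Type) := gen_eqMixin (fps K).
HB.instance Definition _ (K : Type) := gen_choiceMixin (fps K).

Section FpsZmodule.
Variable K : zmodType.
Implicit Types f h : fps K.

Definition fps_zero : fps K := Fps (fun _ => 0).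
Definition fps_opp f : fps K := Fps (fun n => - fcoef f n).
Definition fps_add f h : fps K := Fps (fun n => fcoef f n + fcoef h n).

Lemma fps_addA : associative fps_add.
Proof. by move=> f h k; apply: fpsP => n /=; rewrite addrA. Qed.
Lemma fps_addC : commutative fps_add.
Proof. by move=> f h; apply: fpsP => n /=; rewrite addrC. Qed.
Lemma fps_add0 : left_id fps_zero fps_add.
Proof. by move=> f; apply: fpsP => n /=; rewrite add0r. Qed.
Lemma fps_addN : left_inverse fps_zero fps_opp fps_add.
Proof. by move=> f; apply: fpsP => n /=; rewrite addNr. Qed.

HB.instance Definition _ := GRing.isZmodule.Build (fps K)
  fps_addA fps_addC fps_add0 fps_addN.

End FpsZmodule.

Section FpsRing.
Variable K : comNzRingType.
Implicit Types f h k : fps K.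

Definition fps_one : fps K := Fps (fun n => (n == 0)%:R).
Definition fps_mul f h : fps K :=
  Fps (fun n => \sum_(i < n.+1) fcoef f i * fcoef h (n - i)).
Definition fps_scale (a : K) f : fps K := Fps (fun n => a * fcoef f n).

Definition fps_trunc (N : nat) f : {poly K} := \poly_(i < N) fcoef f i.

Lemma coef_fps_trunc N f n : (n < N)%N -> (fps_trunc N f)`_n = fcoef f n.
Proof. by rewrite coef_poly => ->. Qed.

Lemma coef_fps_mul N f h n : (n < N)%N ->
  fcoef (fps_mul f h) n = (fps_trunc N f * fps_trunc N h)`_n.
Proof.
move=> nN; rewrite coefM /=; apply: eq_bigr => i _.
rewrite !coef_fps_trunc //; first exact: leq_ltn_trans (leq_subr _ _) nN.
by apply: leq_trans nN; exact: ltn_ord.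
Qed.

Lemma fps_mulC : commutative fps_mul.
Proof.
by move=> f h; apply: fpsP => n; rewrite !(@coef_fps_mul n.+1) // mulrC.
Qed.

Lemma fps_mulA : associative fps_mul.
Proof.
move=> f h k; apply: fpsP => n.
transitivity ((fps_trunc n.+1 f * fps_trunc n.+1 h * fps_trunc n.+1 k)`_n).
  rewrite -mulrA coefM /=; apply: eq_bigr => i _.
  rewrite coef_fps_trunc // -(@coef_fps_mul n.+1) //.
  by rewrite ltnS leq_subr.
rewrite coefM /=; apply: eq_bigr => i _.
by rewrite coef_fps_trunc ?ltnS ?leq_subr // -(@coef_fps_mul n.+1).
Qed.

Lemma fps_mul1 : left_id fps_one fps_mul.
Proof.
move=> f; apply: fpsP => n /=; rewrite big_ord_recl /= mul1r subn0.
by rewrite big1 ?addr0 // => i _; rewrite mul0r.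
Qed.

Lemma fps_mulDl : left_distributive fps_mul +%R.
Proof.
move=> f h k; apply: fpsP => n /=; rewrite -big_split /=.
by apply: eq_bigr => i _; rewrite mulrDl.
Qed.

Lemma fps_one_neq0 : fps_one != 0.
Proof.
by apply/eqP => /(congr1 (fun f => fcoef f 0)) /= /eqP; rewrite oner_eq0.
Qed.

HB.instance Definition _ := GRing.Zmodule_isComNzRing.Build (fps K)
  fps_mulA fps_mulC fps_mul1 fps_mulDl fps_one_neq0.

Lemma fps_scaleA (a b : K) f :
  fps_scale a (fps_scale b f) = fps_scale (a * b) f.
Proof. by apply: fpsP => n /=; rewrite mulrA. Qed.
Lemma fps_scale1 : left_id 1 fps_scale.
Proof. by move=> f; apply: fpsP => n /=; rewrite mul1r. Qed.
Lemma fps_scaleDr : right_distributive fps_scale +%R.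
Proof. by move=> a f h; apply: fpsP => n /=; rewrite mulrDr. Qed.
Lemma fps_scaleDl f : {morph fps_scale^~ f : a b / a + b}.
Proof. by move=> a b; apply: fpsP => n /=; rewrite mulrDl. Qed.

HB.instance Definition _ := GRing.Zmodule_isLmodule.Build K (fps K)
  fps_scaleA fps_scale1 fps_scaleDr fps_scaleDl.

Definition fpsX : fps K := Fps (fun n => (n == 1)%:R).

End FpsRing.

Arguments fpsX {K}.

(* [u k] agrees with [l] modulo x^n for all large k. *)
Definition xadic_cvg (K : Type) (u : nat -> fps K) (l : fps K) : Prop :=
  forall n : nat, exists N : nat, forall k : nat, (N <= k)%N ->
    forall i : nat, (i < n)%N -> fcoef (u k) i = fcoef l i.

(* Meaningful only when f has zero constant term: then f ^+ k has order at
   least k, so the terms k > n of sum_k f^k / k! do not contribute to the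
   coefficient of x^n; see [fps_exp_cvg]. *)
Definition fps_exp (K : fieldType) (f : fps K) : fps K :=
  Fps (fun n => \sum_(k < n.+1) (k`!%:R)^-1 * fcoef (f ^+ k) n).

(* log (1 - x^m) = - sum_(r >= 1) x^(m r) / r for m >= 1; see
   [log_one_subXn_cvg]. *)
Definition log_one_subXn (K : fieldType) (m : nat) : fps K :=
  Fps (fun n => if (0 < n)%N && (m %| n)%N then - ((n %/ m)%:R)^-1 else 0).

Definition one_subXn_pow (K : fieldType) (m : nat) (b : K) : fps K :=
  fps_exp (b *: log_one_subXn K m).

(* Arithmetic functions on the positive integers are represented by functions on
   nat whose value at 0 is never used. *)
Definition bell_transform (K : fieldType) (g : nat -> K) : fps K :=
  fps_exp (- Fps (fun n => if (0 < n)%N then g n / n%:R else 0)).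

Definition mobius (n : nat) : int :=
  if all (fun p => ~~ (p ^ 2 %| n)%N) (primes n)
  then (-1) ^+ size (primes n) else 0.

Definition dirichlet_conv (K : pzRingType) (f h : nat -> K) (n : nat) : K :=
  \sum_(d <- divisors n) f d * h (n %/ d)%N.

Definition bell_exponent (K : fieldType) (g : nat -> K) (m : nat) : K :=
  (m%:R)^-1 * \sum_(d <- divisors m) (mobius d)%:~R * g (m %/ d)%N.

Section Convergence.
Variable K : fieldType.
Implicit Types f : fps K.

Lemma fcoef_sum (I : Type) (r : seq I) (P : pred I) (F : I -> fps K) n :
  fcoef (\sum_(i <- r | P i) F i) n = \sum_(i <- r | P i) fcoef (F i) n.
Proof. by elim/big_rec2: _ => //= i y1 y2 _ <-. Qed.

Lemma fcoef_exp_small f k n :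
  fcoef f 0 = 0 -> (n < k)%N -> fcoef (f ^+ k) n = 0.
Proof.
move=> f0; elim: k n => [//|k IHk] n nk; rewrite exprS /=.
rewrite big_ord_recl f0 mul0r add0r big1 // => i _.
rewrite IHk ?mulr0 //=; case: n nk i => [|n] nk [i i_lt] //=.
rewrite ltnS in nk; rewrite /bump leq0n add1n subSS.
exact: leq_ltn_trans (leq_subr _ _) nk.
Qed.

Lemma fps_exp_cvg f : fcoef f 0 = 0 ->
  xadic_cvg (fun N => \sum_(k < N) (k`!%:R)^-1 *: f ^+ k) (fps_exp f).
Proof.
move=> f0 n; exists n => N nN i lt_in; rewrite fcoef_sum /=.
have iN : (i < N)%N by apply: leq_trans nN.
rewrite -(big_mkord xpredT (fun k => (k`!%:R)^-1 * fcoef (f ^+ k) i)).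
rewrite -(big_mkord xpredT (fun k => fcoef ((k`!%:R)^-1 *: f ^+ k) i)).
have tail0 : \sum_(i.+1 <= k < N) (k`!%:R)^-1 * fcoef (f ^+ k) i = 0.
  by rewrite big_nat big1 // => k /andP[ik _]; rewrite fcoef_exp_small // mulr0.
by rewrite (big_cat_nat (n := i.+1)) //= tail0 addr0.
Qed.

Lemma fcoef_fpsXn k n : fcoef (fpsX ^+ k : fps K) n = (n == k)%:R.
Proof.
elim: k n => [//|k IHk] n; rewrite exprS /=.
case: n => [|n]; first by rewrite big_ord_recl big_ord0 /= mul0r addr0.
rewrite 2!big_ord_recl /= mul0r add0r mul1r big1; last first.
  by move=> i _; rewrite mul0r.
by rewrite addr0 IHk /bump /= add1n subSS subn0.
Qed.

Lemma log_one_subXn_cvg m : (0 < m)%N ->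
  xadic_cvg (fun N => - \sum_(1 <= r < N) (r%:R)^-1 *: fpsX ^+ (m * r))
    (log_one_subXn K m).
Proof.
move=> m0 n; exists n => N nN i lt_in; rewrite /= fcoef_sum /=.
under eq_bigr => r _ do rewrite fcoef_fpsXn.
have [/andP[i0 /dvdnP[q def_i]]|ndiv] := boolP ((0 < i)%N && (m %| i)%N).
  have q0 : (0 < q)%N by case: q def_i i0 => // ->.
  have qN : (q < N)%N.
    by apply: leq_trans (leq_trans lt_in nN); rewrite ltnS def_i leq_pmulr.
  rewrite (bigD1_seq q) ?mem_index_iota ?q0 ?iota_uniq //=.
  rewrite def_i mulnK // [(m * q)%N]mulnC eqxx mulr1 big1 ?addr0 // => r rq.
  by rewrite [(m * r)%N]mulnC eqn_pmul2r // eq_sym (negbTE rq) mulr0.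
rewrite big_nat big1 ?oppr0 // => r /andP[r0 _]; case: eqP => [ei|_].
  by move: ndiv; rewrite ei dvdn_mulr // muln_gt0 m0 r0.
by rewrite mulr0.
Qed.

End Convergence.

(* Main.v *)
(* For power series without constant term, E = exp f is the unique solution of
   x E' = (x f') E with E_0 = 1, and its coefficients below x^N depend only on
   those of f.  Uniqueness turns sums into products, so the partial product up to
   M is exp (sum_(m <= M) beta_g(m) log (1 - x^m)).  For 0 < n <= M the x^n
   coefficient of this exponent is - (1/n) sum_(m | n) m beta_g(m), which is
   - g(n) / n by Moebius inversion. *)
Require Import Defs.
From mathcomp Require Import all_boot all_order all_algebra.
From mathcomp Require Import reals complex ring.
Import GRing.Theory Num.Theory.
Local Open Scope ring_scope.

(** * Divisor sums and Moebius inversion *)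

Lemma perm_divisors_mul (e n : nat) : (0 < n)%N -> (e %| n)%N ->
  perm_eq [seq m <- divisors n | (e %| m)%N]
          [seq (e * d)%N | d <- divisors (n %/ e)].
Proof.
move=> n0 /dvdnP[q def_n]; move: n0; rewrite {}def_n muln_gt0 => /andP[q0 e0].
rewrite mulnK //; apply: uniq_perm.
- by rewrite filter_uniq ?divisors_uniq.
- rewrite map_inj_uniq ?divisors_uniq // => a b /eqP.
  by rewrite eqn_pmul2l // => /eqP.
move=> m; rewrite mem_filter -dvdn_divisors ?muln_gt0 ?q0 //.
apply/andP/mapP => [[/dvdnP[d ->]]|[d]].
  by rewrite dvdn_pmul2r // => dq; exists d; rewrite -?dvdn_divisors 1?mulnC.
rewrite -dvdn_divisors // => dq ->; rewrite dvdn_mulr //; split=> //.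
by rewrite [(q * e)%N]mulnC dvdn_pmul2l.
Qed.

Lemma big_divisors_mul (V : nmodType) (e n : nat) (F : nat -> V) :
  (0 < n)%N -> (e %| n)%N ->
  \sum_(m <- divisors n | (e %| m)%N) F m
  = \sum_(d <- divisors (n %/ e)) F (e * d)%N.
Proof.
move=> n0 en; rewrite -big_filter (perm_big _ (perm_divisors_mul e n n0 en)) /=.
by rewrite big_map.
Qed.

Lemma big_divisors_compl (V : nmodType) (n : nat) (F : nat -> V) : (0 < n)%N ->
  \sum_(d <- divisors n) F d = \sum_(d <- divisors n) F (n %/ d)%N.
Proof.
move=> n0; rewrite -(big_map (fun d => n %/ d)%N xpredT F); apply: perm_big.
have invK d : d \in divisors n -> (n %/ (n %/ d))%N = d.
  by rewrite -dvdn_divisors // => dn; rewrite divnA // mulKn.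
apply: uniq_perm; rewrite ?divisors_uniq //.
  rewrite map_inj_in_uniq ?divisors_uniq // => a b an bn ab.
  by rewrite -(invK a an) ab invK.
move=> d; apply/idP/mapP => [dn|[e en ->]].
  exists (n %/ d)%N; last by rewrite invK.
  move: dn; rewrite -!dvdn_divisors // => dn.
  by rewrite dvdn_divLR ?dvdn_mulr ?(dvdn_gt0 n0).
move: en; rewrite -!dvdn_divisors // => en.
by rewrite dvdn_divLR ?dvdn_mulr ?(dvdn_gt0 n0).
Qed.

(** If [p] divides [d], then [p ^ 2] divides [p * d]. Otherwise [p * d] has exactly one more prime
    factor, and divisibility by squares of primes is unaffected. *)
Lemma mobius_primeM (p d : nat) : prime p -> (0 < d)%N ->
  mobius (p * d) = if (p %| d)%N then 0 else - mobius d.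
Proof.
move=> p_pr d0; have p0 := prime_gt0 p_pr.
have memE : primes (p * d) =i p :: primes d.
  by move=> q; rewrite inE primesM // primes_prime // inE.
rewrite /mobius; have [pd|npd] := boolP (p %| d)%N.
  case: allP => // /(_ p); rewrite memE inE eqxx => /(_ isT).
  by rewrite expnS expn1 dvdn_pmul2l // pd.
have peq : perm_eq (primes (p * d)) (p :: primes d).
  apply: uniq_perm memE; rewrite ?primes_uniq //= primes_uniq andbT.
  by rewrite mem_primes (negbTE npd) !andbF.
rewrite (perm_all _ peq) (perm_size peq) /=.
rewrite expnS expn1 dvdn_pmul2l // npd /=.
rewrite (@eq_in_all _ _ (fun q => ~~ (q ^ 2 %| d)%N)); last first.
  (* A prime [q] dividing [d] differs from [p], so [q ^ 2] is coprime to [p]. *)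
  move=> q; rewrite mem_primes => /and3P[q_pr _ qd]; rewrite Gauss_dvdr //.
  rewrite coprime_sym coprimeXr // prime_coprime // dvdn_prime2 //.
  by apply: contraNneq npd => ->.
by case: ifP; rewrite ?oppr0 // exprS mulN1r.
Qed.

(* Pairing d with p d for a prime p dividing n cancels all terms. *)
Lemma sum_mobius (n : nat) : (0 < n)%N ->
  \sum_(d <- divisors n) mobius d = (n == 1%N)%:R.
Proof.
move=> n0; have [->|n1] := eqVneq n 1%N; first by rewrite big_seq1.
have n_gt1 : (1 < n)%N by case: n n0 n1 => [|[|n]].
set p := pdiv n; have p_pr : prime p by exact: pdiv_prime.
have pn : (p %| n)%N by exact: pdiv_dvd.
have p0 := prime_gt0 p_pr.
have np0 : (0 < n %/ p)%N by rewrite divn_gt0 // dvdn_leq.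
rewrite (bigID (fun d => p %| d)%N) /= big_divisors_mul //.
have -> : \sum_(d <- divisors (n %/ p)) mobius (p * d)
        = - \sum_(d <- divisors (n %/ p) | ~~ (p %| d)%N) mobius d.
  rewrite -sumrN [RHS]big_mkcond /= big_seq [RHS]big_seq; apply: eq_bigr => d.
  rewrite -dvdn_divisors // => dn; rewrite mobius_primeM //; first by case: ifP.
  exact: dvdn_gt0 dn.
apply/eqP; rewrite addrC subr_eq0; apply/eqP.
(* The divisors prime to [p] are the same for [n] and for [n %/ p]. *)
rewrite -big_filter -[RHS]big_filter; apply: perm_big.
apply: uniq_perm; rewrite ?filter_uniq ?divisors_uniq // => d.
rewrite !mem_filter -!dvdn_divisors //; case: (boolP (p %| d)%N) => //= npd.
by rewrite -{1}(divnK pn) Gauss_dvdl // coprime_sym prime_coprime.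
Qed.

(** After exchanging the sums, [g e] is weighted by the sum of [mobius] over the divisors of
    [n %/ e], which vanishes unless [e = n]. *)
Lemma mobius_inversion (K : pzRingType) (g : nat -> K) (n : nat) : (0 < n)%N ->
  \sum_(m <- divisors n) dirichlet_conv (fun d => (mobius d)%:~R) g m = g n.
Proof.
move=> n0; rewrite /dirichlet_conv.
(* With [e = m %/ d] as inner index, running over a range independent of [m], the sums can be
   exchanged. *)
transitivity (\sum_(m <- divisors n) \sum_(e <- divisors n | (e %| m)%N)
   (mobius (m %/ e))%:~R * g e).
  rewrite big_seq [RHS]big_seq; apply: eq_bigr => m.
  rewrite -dvdn_divisors // => mn; have m0 := dvdn_gt0 n0 mn.
  have divs : perm_eq [seq e <- divisors n | (e %| m)%N] (divisors m).
    apply: uniq_perm; rewrite ?filter_uniq ?divisors_uniq // => e.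
    rewrite mem_filter -!dvdn_divisors //; case: (boolP (e %| m)%N) => //= em.
    exact: dvdn_trans em mn.
  rewrite big_divisors_compl // -[RHS]big_filter (perm_big _ divs) /=.
  rewrite big_seq [RHS]big_seq; apply: eq_bigr => e.
  by rewrite -dvdn_divisors // => em; rewrite divnA // mulKn.
rewrite (exchange_big_dep xpredT) //=.
rewrite big_seq (eq_bigr (fun e => (n %/ e == 1)%N%:R * g e)); last first.
  move=> e; rewrite -dvdn_divisors // => en; have e0 := dvdn_gt0 n0 en.
  rewrite big_divisors_mul // -mulr_suml; congr (_ * _).
  under eq_bigr => d _ do rewrite mulKn //.
  rewrite -(rmorph_sum (intmul (1 : K))) sum_mobius ?rmorph_nat //.
  by rewrite divn_gt0 // dvdn_leq.
rewrite -big_seq (bigD1_seq n) ?divisors_uniq ?divisors_id //=.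
rewrite divnn n0 eqxx mul1r big_seq_cond big1 ?addr0 // => e /andP[].
rewrite -dvdn_divisors // => en e_n; case: eqP => [ne1|]; last by rewrite mul0r.
by move: e_n; rewrite -[in X in _ != X](divnK en) ne1 mul1n eqxx.
Qed.

(** * The derivation x d/dx and the formal exponential *)

(** This is x d/dx; unlike d/dx, it keeps degrees, so that coefficients need no index shift. *)
Definition fps_euler {K : comNzRingType} (f : fps K) : fps K :=
  Fps (fun n => n%:R * fcoef f n).

Lemma fps_eulerD (K : comNzRingType) (f h : fps K) :
  fps_euler (f + h) = fps_euler f + fps_euler h.
Proof. by apply: fpsP => n /=; rewrite mulrDr. Qed.

Lemma fps_eulerM (K : comNzRingType) (f h : fps K) :
  fps_euler (f * h) = fps_euler f * h + f * fps_euler h.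
Proof.
apply: fpsP => n /=; rewrite mulr_sumr -big_split /=; apply: eq_bigr => i _.
by rewrite natrB -1?ltnS //; ring.
Qed.

Lemma fps_eulerX (K : comNzRingType) (f : fps K) (k : nat) :
  fps_euler (f ^+ k.+1) = k.+1%:R *: (f ^+ k * fps_euler f).
Proof.
elim: k => [|k IHk]; first by rewrite scale1r mul1r.
rewrite exprS fps_eulerM {}IHk !scaler_nat mulrnAr mulrA -exprS.
by rewrite [fps_euler f * _]mulrC -mulrS.
Qed.

(** The extra terms vanish because [f ^+ k] has order at least [k]; a common bound can thus serve
    for several coefficients. *)
Lemma fcoef_fps_exp (K : fieldType) (f : fps K) (n N : nat) :
  fcoef f 0 = 0 -> (n < N)%N ->
  fcoef (fps_exp f) n = \sum_(k < N) (k`!%:R)^-1 * fcoef (f ^+ k) n.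
Proof.
move=> f0 nN.
rewrite /= (big_ord_widen N (fun k => (k`!%:R)^-1 * fcoef (f ^+ k) n)) //.
rewrite big_mkcond; apply: eq_bigr => k _; rewrite ltnS.
by case: leqP => // nk; rewrite fcoef_exp_small // mulr0.
Qed.

Lemma fcoef_fps_exp0 (K : fieldType) (f : fps K) : fcoef (fps_exp f) 0 = 1.
Proof. by rewrite /= big_ord1 fact0 invr1 mulr1. Qed.

(** Termwise, x d/dx sends f^(k+1)/(k+1)! to (x f') f^k/k!. *)
Lemma fps_euler_exp (K : numFieldType) (f : fps K) : fcoef f 0 = 0 ->
  fps_euler (fps_exp f) = fps_euler f * fps_exp f.
Proof.
move=> f0; apply: fpsP => n.
transitivity (\sum_(k < n) (k`!%:R)^-1 * fcoef (fps_euler f * f ^+ k) n).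
  (* The term [k = 0] is the constant 1, which x d/dx kills; this leaves [n] terms. *)
  rewrite [LHS]/= big_ord_recl mulrDr [X in X + _](_ : _ = 0) ?add0r; last first.
    by case: n => [|n] /=; rewrite ?mul0r ?mulr0.
  rewrite mulr_sumr; apply: eq_bigr => k _; rewrite lift0.
  have -> : fps_euler f * f ^+ k = k.+1%:R^-1 *: fps_euler (f ^+ k.+1).
    by rewrite fps_eulerX scalerA mulVf ?scale1r ?pnatr_eq0 // mulrC.
  rewrite [in RHS]/= factS natrM invfM; ring.
under eq_bigr => k _ do rewrite [fcoef _ n]/= mulr_sumr.
rewrite exchange_big /=; apply: eq_bigr => -[[|i] /= i_n] _.
  by rewrite mul0r mul0r big1 // => k _; rewrite !mul0r mulr0.
(* As x f' has no constant term, only degrees [n - i.+1 < n] of the exponential occur, for which [n]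
   terms suffice. *)
rewrite -[X in _ = _ * X]/(fcoef (fps_exp f) (n - i.+1)).
rewrite (@fcoef_fps_exp _ _ _ n) //; last first.
  by rewrite ltn_subrL (leq_ltn_trans (leq0n i) i_n).
by rewrite mulr_sumr; apply: eq_bigr => k _; ring.
Qed.

(* The n-th coefficient of the equation determines the n-th coefficient of E
   because the coefficient G_0 vanishes. *)
Lemma fps_euler_unique (K : numFieldType) (N : nat) (G G' E E' : fps K) :
  fps_euler E = G * E -> fps_euler E' = G' * E' ->
  fcoef G 0 = 0 -> (forall i, (i < N)%N -> fcoef G i = fcoef G' i) ->
  fcoef E 0 = fcoef E' 0 ->
  forall n, (n < N)%N -> fcoef E n = fcoef E' n.
Proof.
move=> eqE eqE' G0 GG' E0; elim/ltn_ind => -[//|n] IHn nN.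
have n1 : n.+1%:R != 0 :> K by rewrite pnatr_eq0.
apply: (mulfI n1).
rewrite -[LHS]/(fcoef (fps_euler E) n.+1) -[RHS]/(fcoef (fps_euler E') n.+1).
rewrite eqE eqE' /= [LHS]big_ord_recl [RHS]big_ord_recl.
rewrite -GG' ?(leq_trans _ nN) // G0 !mul0r.
congr (_ + _); apply: eq_bigr => i _; rewrite lift0 subSS.
rewrite GG' ?(leq_ltn_trans (ltn_ord i) nN) // IHn ?ltnS ?leq_subr //.
exact: leq_ltn_trans (leq_subr i n) (ltnW nN).
Qed.

(** Both sides solve x E' = x (f + h)' E with constant term 1. *)
Lemma fps_expD (K : numFieldType) (f h : fps K) :
  fcoef f 0 = 0 -> fcoef h 0 = 0 ->
  fps_exp (f + h) = fps_exp f * fps_exp h.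
Proof.
move=> f0 h0; apply: fpsP => n.
apply: (@fps_euler_unique K n.+1 (fps_euler (f + h)) (fps_euler (f + h))) => //.
- by apply: fps_euler_exp; rewrite /= f0 h0 addr0.
- by rewrite fps_eulerM !fps_euler_exp // fps_eulerD; ring.
- by rewrite /= mul0r.
- rewrite -[RHS]/(\sum_(i < 1) fcoef (fps_exp f) i * fcoef (fps_exp h) (0 - i)).
  by rewrite big_ord1 !fcoef_fps_exp0 mulr1.
Qed.

Lemma fps_exp0 (K : fieldType) : fps_exp 0 = 1 :> fps K.
Proof.
apply: fpsP => n /=; rewrite big_ord_recl big1 => [|k _].
  by rewrite fact0 invr1 mul1r addr0.
by rewrite expr0n /= mulr0.
Qed.

Lemma fps_exp_sum (K : numFieldType) (I : Type) (r : seq I) (P : pred I)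
    (F : I -> fps K) : (forall i, P i -> fcoef (F i) 0 = 0) ->
  fps_exp (\sum_(i <- r | P i) F i) = \prod_(i <- r | P i) fps_exp (F i).
Proof.
move=> F0; elim: r => [|i r IHr]; first by rewrite !big_nil fps_exp0.
rewrite !big_cons; case: ifP => // Pi; rewrite fps_expD ?F0 ?IHr //.
by rewrite fcoef_sum big1.
Qed.

(** This truncated form is what allows a finite partial product to be compared with its limit. *)
Lemma eq_fcoef_fps_exp (K : numFieldType) (N : nat) (f h : fps K) :
  fcoef f 0 = 0 -> fcoef h 0 = 0 ->
  (forall i, (i < N)%N -> fcoef f i = fcoef h i) ->
  forall n, (n < N)%N -> fcoef (fps_exp f) n = fcoef (fps_exp h) n.
Proof.
move=> f0 h0 fh; apply: fps_euler_unique (fps_euler_exp _ _ f0)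
  (fps_euler_exp _ _ h0) _ _ _; rewrite ?fcoef_fps_exp0 //= ?mul0r //.
by move=> i iN; rewrite fh.
Qed.

(** * Bell exponents and the Euler product *)

Lemma mulr_bell_exponent (K : numFieldType) (g : nat -> K) (m : nat) :
  (0 < m)%N -> m%:R * bell_exponent g m
    = dirichlet_conv (fun d => (mobius d)%:~R) g m.
Proof. by move=> m0; rewrite mulVKf // pnatr_eq0 -lt0n. Qed.

(** Only the [m] dividing [n] contribute, each giving - b(m) m/n; [n <= M] ensures that all divisors
    of [n] are in range. *)
Lemma fcoef_sum_log_one_subXn (K : numFieldType) (b : nat -> K) (n M : nat) :
  (0 < n)%N -> (n <= M)%N ->
  fcoef (\sum_(1 <= m < M.+1) b m *: log_one_subXn K m) n
  = - (n%:R^-1 * \sum_(m <- divisors n) m%:R * b m).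
Proof.
move=> n0 nM; rewrite fcoef_sum /= n0 /= mulr_sumr -sumrN.
rewrite [RHS](perm_big [seq m <- index_iota 1 M.+1 | (m %| n)%N]) /=; last first.
  apply: uniq_perm; rewrite ?filter_uniq ?divisors_uniq ?iota_uniq // => m.
  rewrite mem_filter -dvdn_divisors // mem_index_iota ltnS.
  case: (boolP (m %| n)%N) => //= mn; rewrite (dvdn_gt0 n0 mn).
  by rewrite (leq_trans (dvdn_leq n0 mn)).
rewrite big_filter [RHS]big_mkcond [LHS]big_nat [RHS]big_nat /=.
apply: eq_bigr => m /andP[m0 _]; case: ifP => mn; last by rewrite mulr0.
have mN0 : m%:R != 0 :> K by rewrite pnatr_eq0 -lt0n.
have nN0 : n%:R != 0 :> K by rewrite pnatr_eq0 -lt0n.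
rewrite natf_div // invf_div; ring.
Qed.

Theorem theorem2p1 (R : realType) (g : nat -> R[i]) :
  xadic_cvg
    (fun M : nat => \prod_(1 <= m < M.+1) one_subXn_pow m (bell_exponent g m))
    (bell_transform g)
  /\ (forall m : nat, (0 < m)%N ->
        m%:R * bell_exponent g m
        = dirichlet_conv (fun d : nat => (mobius d)%:~R) g m).
Proof.
split=> [n|m m0]; last exact: mulr_bell_exponent.
(* The threshold [n] works: a divisor of a positive index below [n] is at most [M], so later factors
   do not affect these coefficients. *)
exists n => M nM i lt_in; rewrite -fps_exp_sum; last first.
  by move=> m _; rewrite /= mulr0.
apply: (@eq_fcoef_fps_exp _ n) lt_in => [||[|j] jn].
- by rewrite fcoef_sum big1 // => m _; rewrite /= mulr0.
- by rewrite /= oppr0.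
- by rewrite fcoef_sum big1 /= ?oppr0 // => m _; rewrite mulr0.
rewrite fcoef_sum_log_one_subXn //; last exact: ltnW (leq_trans jn nM).
rewrite big_seq (eq_bigr (dirichlet_conv (fun d => (mobius d)%:~R) g)).
  by rewrite -big_seq mobius_inversion //= mulrC.
move=> m; rewrite -dvdn_divisors // => mj.
by rewrite mulr_bell_exponent // (dvdn_gt0 _ mj).
Qed.
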